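(* Let $\mathbb F$ be a field and let $\hat H$ be the universal double affine Hecke algebra of type $(C_1^\vee,C_1)$ over $\mathbb F$. Given nonzero scalars $k_0,k_1,k^\vee_0,k^\vee_1,q$ in $\mathbb F$, there exists a surjective $\mathbb F$-algebra homomorphism $\hat H\to H(k_0,k_1,k^\vee_0,k^\vee_1;q)$ that sends $Q\mapsto q$ and $t_i\mapsto t_i$, $t^\vee_i\mapsto t^\vee_i$ for $i\in\{0,1\}$.
   Context: All algebras are associative with $1$. $\hat H$ is the $\mathbb F$-algebra defined by generators $t_i^{\pm1}$, $(t_i^\vee)^{\pm1}$ $(i=0,1)$ and relations: $t_it_i^{-1}=t_i^{-1}t_i=1$, $t^\vee_it^{\vee -1}_i=t^{\vee -1}_it^\vee_i=1$; $t_i+t_i^{-1}$ is central and $t^\vee_i+t^{\vee -1}_i$ is central $(i=0,1)$; $t^\vee_0t_0t^\vee_1t_1$ is central. Here $t^{\vee -1}_i=(t^\vee_i)^{-1}$. In $\hat H$ the element $t^\vee_0t_0t^\vee_1t_1$ is invertible and $Q$ denotes its inverse. $H(k_0,k_1,k^\vee_0,k^\vee_1;q)$ is the $\mathbb F$-algebra defined by generators (denoted by the same symbols) $t_i$, $t^\vee_i$ $(i=0,1)$ and relations $$(t_i-k_i)(t_i-k_i^{-1})=0,\qquad (t^\vee_i-k^\vee_i)(t^\vee_i-(k^{\vee}_i)^{-1})=0\quad(i=0,1),\qquad t^\vee_0t_0t^\vee_1t_1=q^{-1}.$$ *)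

(* Defs.v *)
From HB Require Import structures.
From mathcomp Require Import all_boot all_algebra.
From mathcomp Require Import finmap generic_quotient boolp monalg.

Set Implicit Arguments.
Unset Strict Implicit.
Unset Printing Implicit Defensive.

Import GRing.Theory.
Local Open Scope ring_scope.
Local Open Scope quotient_scope.

Section FreeAlgebra.
Variables (F : fieldType) (X : choiceType).

(* The algebra of the free monoid on X. *)
Definition freeAlg : Type := {malg F[{fmonom X}]}.

Definition fvar (x : X) : freeAlg := << fmu x >>.

HB.instance Definition _ := GRing.Lalgebra.on freeAlg.

Lemma freeAlg_scalerAr (a : F) (u v : freeAlg) : a *: (u * v) = u * (a *: v).
Proof.
apply/malgP => k; rewrite mcoeffZ mcoeffMl.
rewrite (mcoeffMlw (d1 := msupp u) (d2 := msupp v)) ?fsubset_refl ?msuppZ_le //.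
rewrite mulr_sumr; apply: eq_bigr => i _.
rewrite mulr_sumr; apply: eq_bigr => j _.
by rewrite mcoeffZ mulrnAr mulrCA.
Qed.

HB.instance Definition _ :=
  GRing.Lalgebra_isAlgebra.Build F freeAlg freeAlg_scalerAr.

End FreeAlgebra.

Section PresentedAlgebra.
Variables (F : fieldType) (X : choiceType).
Variable rel : freeAlg F X -> freeAlg F X -> Prop.

(* The two-sided ideal generated by the differences of related elements;
   absorption of arbitrary left factors makes it stable under scaling. *)
Inductive relIdeal : freeAlg F X -> Prop :=
| relIdeal_rel u v of rel u v : relIdeal (u - v)
| relIdeal_0 : relIdeal 0
| relIdeal_B u v of relIdeal u & relIdeal v : relIdeal (u - v)
| relIdeal_Ml w u of relIdeal u : relIdeal (w * u)
| relIdeal_Mr u w of relIdeal u : relIdeal (u * w).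

Let eqm (u v : freeAlg F X) : bool := `[< relIdeal (u - v) >].

Lemma relIdeal_opp u : relIdeal u -> relIdeal (- u).
Proof. by rewrite -sub0r => hu; apply: relIdeal_B hu; apply: relIdeal_0. Qed.

Lemma relIdeal_add u v : relIdeal u -> relIdeal v -> relIdeal (u + v).
Proof.
by move=> hu /relIdeal_opp hv; rewrite -[v]opprK; apply: relIdeal_B.
Qed.

Lemma relIdeal_scale a u : relIdeal u -> relIdeal (a *: u).
Proof.
have -> : a *: u = a%:A * u by rewrite -scalerAl mul1r.
exact: relIdeal_Ml.
Qed.

Lemma eqm_equiv : equiv_class_of eqm.
Proof.
split=> [u|u v|v u w]; rewrite /eqm.
- by apply/asboolP; rewrite subrr; apply: relIdeal_0.
- by apply/asboolP/asboolP => /relIdeal_opp; rewrite opprB.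
- move=> /asboolP huv /asboolP hvw; apply/asboolP.
  by rewrite -(subrKA v); apply: relIdeal_add.
Qed.

Canonical eqm_equivRel := EquivRelPack eqm_equiv.

Definition presAlg : Type := {eq_quot eqm}.
HB.instance Definition _ := Choice.on presAlg.
HB.instance Definition _ := EqQuotient.on presAlg.

Lemma presAlg_eqP (u v : freeAlg F X) :
  reflect (relIdeal (u - v)) (u == v %[mod presAlg]).
Proof. by rewrite eqmodE; apply: asboolP. Qed.

Let zero : presAlg := lift_cst presAlg 0.
Let one : presAlg := lift_cst presAlg 1.
Let opp := lift_op1 presAlg -%R.
Let add := lift_op2 presAlg +%R.
Let mul := lift_op2 presAlg *%R.
Let scale (a : F) := lift_op1 presAlg ( *:%R a).

Let pi_zero : \pi_presAlg 0 = zero.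
Proof. by rewrite /zero; unlock. Qed.

Let pi_one : \pi_presAlg 1 = one.
Proof. by rewrite /one; unlock. Qed.

Let pi_opp : {morph \pi_presAlg : u / - u >-> opp u}.
Proof.
move=> u; unlock opp; apply/eqP/presAlg_eqP; rewrite -opprD.
by apply/relIdeal_opp/presAlg_eqP; rewrite reprK.
Qed.

Let pi_add : {morph \pi_presAlg : u v / u + v >-> add u v}.
Proof.
move=> u v; unlock add; apply/eqP/presAlg_eqP; rewrite opprD addrACA.
by apply: relIdeal_add; apply/presAlg_eqP; rewrite reprK.
Qed.

Let pi_mul : {morph \pi_presAlg : u v / u * v >-> mul u v}.
Proof.
move=> u v; unlock mul; apply/eqP/presAlg_eqP.
rewrite -(subrKA (repr (\pi_presAlg u) * v)) -mulrBl -mulrBr.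
by apply: relIdeal_add; [apply: relIdeal_Mr | apply: relIdeal_Ml];
  apply/presAlg_eqP; rewrite reprK.
Qed.

Let pi_scale a : {morph \pi_presAlg : u / a *: u >-> scale a u}.
Proof.
move=> u; unlock scale; apply/eqP/presAlg_eqP; rewrite -scalerBr.
by apply/relIdeal_scale/presAlg_eqP; rewrite reprK.
Qed.

Let addA : associative add.
Proof. by elim/quotW=> u; elim/quotW=> v; elim/quotW=> w; rewrite -!pi_add addrA. Qed.

Let addC : commutative add.
Proof. by elim/quotW=> u; elim/quotW=> v; rewrite -!pi_add addrC. Qed.

Let add0 : left_id zero add.
Proof. by elim/quotW=> u; rewrite -pi_zero -pi_add add0r. Qed.

Let addN : left_inverse zero opp add.
Proof. by elim/quotW=> u; rewrite -pi_opp -pi_add addNr pi_zero. Qed.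

Let mulA : associative mul.
Proof. by elim/quotW=> u; elim/quotW=> v; elim/quotW=> w; rewrite -!pi_mul mulrA. Qed.

Let mul1 : left_id one mul.
Proof. by elim/quotW=> u; rewrite -pi_one -pi_mul mul1r. Qed.

Let mulx1 : right_id one mul.
Proof. by elim/quotW=> u; rewrite -pi_one -pi_mul mulr1. Qed.

Let mulDl : left_distributive mul add.
Proof.
by elim/quotW=> u; elim/quotW=> v; elim/quotW=> w;
  rewrite -!(pi_mul, pi_add) mulrDl.
Qed.

Let mulDr : right_distributive mul add.
Proof.
by elim/quotW=> u; elim/quotW=> v; elim/quotW=> w;
  rewrite -!(pi_mul, pi_add) mulrDr.
Qed.

HB.instance Definition _ := GRing.isZmodule.Build presAlg addA addC add0 addN.
HB.instance Definition _ :=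
  GRing.Zmodule_isPzRing.Build presAlg mulA mul1 mulx1 mulDl mulDr.

Let scaleA a b (u : presAlg) : scale a (scale b u) = scale (a * b) u.
Proof. by elim/quotW: u => u; rewrite -!pi_scale scalerA. Qed.

Let scale1 : left_id 1 scale.
Proof. by elim/quotW=> u; rewrite -pi_scale scale1r. Qed.

Let scaleDr : right_distributive scale +%R.
Proof.
by move=> a; elim/quotW=> u; elim/quotW=> v;
  rewrite -[_ + _]pi_add -!pi_scale scalerDr pi_add.
Qed.

Let scaleDl (u : presAlg) : {morph scale^~ u : a b / a + b}.
Proof.
by elim/quotW: u => u a b; rewrite -!pi_scale scalerDl pi_add.
Qed.

HB.instance Definition _ :=
  GRing.Zmodule_isLmodule.Build F presAlg scaleA scale1 scaleDr scaleDl.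

Definition presPi (u : freeAlg F X) : presAlg := \pi_presAlg u.

Lemma presPi_is_zmod_morphism : zmod_morphism presPi.
Proof.
by move=> u v; rewrite /presPi pi_add pi_opp.
Qed.

Lemma presPi_is_monoid_morphism : monoid_morphism presPi.
Proof. by split=> [|u v]; [apply: pi_one | apply: pi_mul]. Qed.

Lemma presPi_is_scalable : scalable presPi.
Proof. by move=> a u; apply: pi_scale. Qed.

HB.instance Definition _ :=
  GRing.isZmodMorphism.Build (freeAlg F X) presAlg presPi
    presPi_is_zmod_morphism.
HB.instance Definition _ :=
  GRing.isMonoidMorphism.Build (freeAlg F X) presAlg presPi
    presPi_is_monoid_morphism.
HB.instance Definition _ :=
  GRing.isScalable.Build F (freeAlg F X) presAlg *:%R presPi
    presPi_is_scalable.

Lemma presPi_surj (y : presAlg) : exists u, presPi u = y.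
Proof. by elim/quotW: y => u; exists u. Qed.

Lemma presPi_eqP u v : presPi u = presPi v <-> relIdeal (u - v).
Proof.
by split=> [/eqP/presAlg_eqP // | /presAlg_eqP/eqP].
Qed.

(* MathComp's [lalgType] and [algType] exclude the zero ring, whereas a
   presented algebra may be zero; so it carries its ring and module structures
   separately, related by the two algebra axioms below. *)
Lemma presAlg_scalerAl (a : F) (x y : presAlg) : a *: (x * y) = a *: x * y.
Proof.
have [u <-] := presPi_surj x; have [v <-] := presPi_surj y.
by rewrite -rmorphM -!linearZ -rmorphM -scalerAl.
Qed.

Lemma presAlg_scalerAr (a : F) (x y : presAlg) : a *: (x * y) = x * (a *: y).
Proof.
have [u <-] := presPi_surj x; have [v <-] := presPi_surj y.
by rewrite -rmorphM -!linearZ -rmorphM -scalerAr.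
Qed.

Definition pvar (x : X) : presAlg := presPi (fvar F x).

End PresentedAlgebra.

(* T0v and T1v stand for $t_0^\vee$ and $t_1^\vee$. *)
Inductive daha_gen := T0 | T1 | T0v | T1v.

Definition daha_gen_code (g : daha_gen) : 'I_4 :=
  match g with T0 => inord 0 | T1 => inord 1 | T0v => inord 2 | T1v => inord 3 end.

Definition daha_gen_decode (i : 'I_4) : daha_gen :=
  match val i with 0%N => T0 | 1%N => T1 | 2%N => T0v | _ => T1v end.

Lemma daha_gen_codeK : cancel daha_gen_code daha_gen_decode.
Proof. by case; rewrite /daha_gen_decode /= inordK. Qed.

HB.instance Definition _ := Choice.copy daha_gen (can_type daha_gen_codeK).

Section UniversalDAHA.
Variable F : fieldType.

(* [inl g] is the generator g and [inr g] its formal inverse. *)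
Definition hat_gen : choiceType := (daha_gen + daha_gen)%type.

Let t (g : daha_gen) : freeAlg F hat_gen := fvar F (inl g : hat_gen).
Let tV (g : daha_gen) : freeAlg F hat_gen := fvar F (inr g : hat_gen).

Inductive hat_rel : freeAlg F hat_gen -> freeAlg F hat_gen -> Prop :=
| hat_rel_mulV g : hat_rel (t g * tV g) 1
| hat_rel_Vmul g : hat_rel (tV g * t g) 1
| hat_rel_central g y : hat_rel ((t g + tV g) * y) (y * (t g + tV g))
| hat_rel_prod_central y :
    hat_rel (t T0v * t T0 * t T1v * t T1 * y)
            (y * (t T0v * t T0 * t T1v * t T1)).

Definition hatH : Type := presAlg hat_rel.
HB.instance Definition _ := GRing.PzRing.on hatH.
HB.instance Definition _ := GRing.Lmodule.on hatH.

Definition hat_t (g : daha_gen) : hatH := pvar hat_rel (inl g : hat_gen).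
Definition hat_tV (g : daha_gen) : hatH := pvar hat_rel (inr g : hat_gen).

Definition hat_prod : hatH := hat_t T0v * hat_t T0 * hat_t T1v * hat_t T1.

Definition hatQ : hatH := hat_tV T1 * hat_tV T1v * hat_tV T0 * hat_tV T0v.

Lemma hat_tK g : hat_t g * hat_tV g = 1.
Proof.
rewrite -[LHS](rmorphM (presPi hat_rel)) -[RHS](rmorph1 (presPi hat_rel)).
by apply/presPi_eqP/relIdeal_rel; apply: hat_rel_mulV.
Qed.

Lemma hat_tVK g : hat_tV g * hat_t g = 1.
Proof.
rewrite -[LHS](rmorphM (presPi hat_rel)) -[RHS](rmorph1 (presPi hat_rel)).
by apply/presPi_eqP/relIdeal_rel; apply: hat_rel_Vmul.
Qed.

Lemma hat_prodQ : hat_prod * hatQ = 1.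
Proof.
rewrite /hat_prod /hatQ !mulrA -(mulrA _ (hat_t T1)) hat_tK mulr1.
by rewrite -(mulrA _ (hat_t T1v)) hat_tK mulr1
  -(mulrA _ (hat_t T0)) hat_tK mulr1 hat_tK.
Qed.

Lemma hat_Qprod : hatQ * hat_prod = 1.
Proof.
rewrite /hat_prod /hatQ !mulrA -(mulrA _ (hat_tV T0v)) hat_tVK mulr1.
by rewrite -(mulrA _ (hat_tV T0)) hat_tVK mulr1
  -(mulrA _ (hat_tV T1v)) hat_tVK mulr1 hat_tVK.
Qed.

End UniversalDAHA.

Section DAHA.
Variables (F : fieldType) (k0 k1 k0v k1v q : F).

Definition daha_param (g : daha_gen) : F :=
  match g with T0 => k0 | T1 => k1 | T0v => k0v | T1v => k1v end.

Let t (g : daha_gen) : freeAlg F daha_gen := fvar F g.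

Inductive daha_rel : freeAlg F daha_gen -> freeAlg F daha_gen -> Prop :=
| daha_rel_quadratic g :
    daha_rel ((t g - (daha_param g)%:A) * (t g - (daha_param g)^-1%:A)) 0
| daha_rel_prod : daha_rel (t T0v * t T0 * t T1v * t T1) q^-1%:A.

Definition dahaH : Type := presAlg daha_rel.
HB.instance Definition _ := GRing.PzRing.on dahaH.
HB.instance Definition _ := GRing.Lmodule.on dahaH.

Definition daha_t (g : daha_gen) : dahaH := pvar daha_rel g.

End DAHA.

(* Main.v *)
Require Import Defs.
From mathcomp Require Import all_boot all_algebra.
From HB Require Import structures.
From mathcomp Require Import generic_quotient monalg.

Set Implicit Arguments.
Unset Strict Implicit.
Unset Printing Implicit Defensive.

Import GRing.Theory.
Local Open Scope ring_scope.

(** Sending the formal inverse of t_g to (k_g + k_g^-1) - t_g defines a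
    homomorphism from the free algebra of the universal algebra to the free
    algebra of H; the quadratic relation t_g^2 - (k_g + k_g^-1) t_g + 1 = 0 says
    that this element inverts t_g in H, and t_g plus it is a scalar, so all
    relations of the universal algebra hold in H. *)

(** Every element is a linear combination of words, and each word arises from the empty word [1] by
    left multiplication by generators. *)
Lemma freeAlg_ind (F : fieldType) (X : choiceType) (P : freeAlg F X -> Prop) :
    P 1 -> (forall u v, P u -> P v -> P (u + v)) ->
    (forall a u, P u -> P (a *: u)) -> (forall x u, P u -> P (fvar F x * u)) ->
  forall u, P u.
Proof.
move=> P1 PD PZ Pvar u.
have Pmon (s : seq X) : P << FMonom s >>.
  elim: s => [|x s IHs]; first by rewrite -fmoneE.
  suff -> : << FMonom (x :: s) >> = fvar F x * << FMonom s >> by apply: Pvar.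
  rewrite [RHS]malgM_def fgmulUU mulr1; congr << _ >>; apply/eqP.
  by rewrite fmP fmM fmU.
rewrite [u]monalgE; elim/big_ind: _ => // [|[s] _].
  (* The empty sum is covered by writing [0] as [0 *: 1]. *)
  by rewrite -(scale0r 1); apply: PZ.
suff -> : << u@_(FMonom s) *g FMonom s >> = u@_(FMonom s) *: << FMonom s >>.
  exact: PZ.
by apply/malgP=> m; rewrite mcoeffZ !mcoeffU mulr_natr.
Qed.

(** * Universal property of the free algebra *)

Section FreeEval.
Variables (F : fieldType) (X : choiceType) (A : algType F) (v : X -> A).

Definition fmonom_eval (m : {fmonom X}) : A := \prod_(x <- m) v x.

Lemma fmonom_eval_mmorphism : mmorphism fmonom_eval.
Proof.
split=> [m1 m2|]; first by rewrite /fmonom_eval fmM big_cat.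
by rewrite /fmonom_eval fm1 big_nil.
Qed.

HB.instance Definition _ :=
  monalg.isMultiplicative.Build _ _ fmonom_eval fmonom_eval_mmorphism.

Definition freeEval (u : freeAlg F X) : A := mmap (in_alg A) fmonom_eval u.

Lemma freeEval_is_zmod_morphism : zmod_morphism freeEval.
Proof. exact: raddfB. Qed.

Lemma freeEval_is_monoid_morphism : monoid_morphism freeEval.
Proof.
(* Multiplicativity in a noncommutative target needs only that the coefficients commute with the
   values of words; scalars are central. *)
have [|fM f1] := @commr_mmap_is_multiplicative _ _ _ (in_alg A) fmonom_eval.
  by move=> u m m'; apply: comm_alg.
by split.
Qed.

Lemma freeEval_is_scalable : scalable freeEval.
Proof. by move=> a u; rewrite /freeEval mmapZ mulr_algl. Qed.

HB.instance Definition _ := GRing.isZmodMorphism.Build (freeAlg F X) A freeEval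
  freeEval_is_zmod_morphism.
HB.instance Definition _ := GRing.isMonoidMorphism.Build (freeAlg F X) A freeEval
  freeEval_is_monoid_morphism.
HB.instance Definition _ := GRing.isScalable.Build F (freeAlg F X) A *:%R freeEval
  freeEval_is_scalable.

Lemma freeEval_var (x : X) : freeEval (fvar F x) = v x.
Proof.
by rewrite /freeEval mmapU /= scale1r mul1r /fmonom_eval fmU big_seq1.
Qed.

End FreeEval.

(** * Homomorphisms out of a presented algebra *)

Section PresentedLift.
Variables (F : fieldType) (X Y : choiceType).
Variable relX : freeAlg F X -> freeAlg F X -> Prop.
Variable relY : freeAlg F Y -> freeAlg F Y -> Prop.
(* Images of generators are given in the free algebra because [freeEval] needs an
   [algType], which the possibly zero [presAlg relY] is not. *)
Variable v : X -> freeAlg F Y.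

Let ev u : presAlg relY := presPi relY (freeEval v u).

Hypothesis ev_rel : forall u w, relX u w -> ev u = ev w.

Let evB : {morph ev : u w / u - w}.
Proof. by move=> u w; rewrite /ev !raddfB. Qed.

Let evM : {morph ev : u w / u * w}.
Proof. by move=> u w; rewrite /ev !rmorphM. Qed.

(** The zeros of [ev] form a two-sided ideal, which contains the generating differences by
    [ev_rel]. *)
Let ev0 u : relIdeal relX u -> ev u = 0.
Proof.
elim=> {u} [u w /ev_rel e||u w _ eu _ ew|w u _ e|u w _ e].
- by rewrite evB e subrr.
- by rewrite /ev !raddf0.
- by rewrite evB eu ew subr0.
- by rewrite evM e mulr0.
- by rewrite evM e mul0r.
Qed.

Definition presLift (x : presAlg relX) : presAlg relY := ev (repr x).

(** The choice made by [repr] is harmless: two representatives of a class differ by an element of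
    [relIdeal], which [ev] kills. *)
Lemma presLift_pi u : presLift (presPi relX u) = presPi relY (freeEval v u).
Proof.
rewrite -/(ev u); apply/eqP; rewrite -subr_eq0 -evB ev0 //.
by apply/presPi_eqP; rewrite /presPi reprK.
Qed.

Lemma presLift_var x : presLift (pvar relX x) = presPi relY (v x).
Proof. by rewrite presLift_pi freeEval_var. Qed.

Lemma presLift_is_zmod_morphism : zmod_morphism presLift.
Proof.
move=> x y; have [[u <-] [w <-]] := (presPi_surj x, presPi_surj y).
by rewrite -raddfB !presLift_pi !raddfB.
Qed.

Lemma presLift_is_monoid_morphism : monoid_morphism presLift.
Proof.
split=> [|x y]; first by rewrite -(rmorph1 (presPi relX)) presLift_pi !rmorph1.
have [[u <-] [w <-]] := (presPi_surj x, presPi_surj y).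
by rewrite -rmorphM !presLift_pi !rmorphM.
Qed.

Lemma presLift_is_scalable : scalable presLift.
Proof.
move=> a x; have [u <-] := presPi_surj x.
by rewrite -linearZ !presLift_pi !linearZ.
Qed.

Lemma presLift_rmorphism :
  exists phi : {rmorphism presAlg relX -> presAlg relY},
    scalable phi /\ forall x, phi (pvar relX x) = presPi relY (v x).
Proof.
pose zM := GRing.isZmodMorphism.Build _ _ presLift presLift_is_zmod_morphism.
pose mM := GRing.isMonoidMorphism.Build _ _ presLift presLift_is_monoid_morphism.
pose phi : {rmorphism presAlg relX -> presAlg relY} :=
  HB.pack presLift zM mM.
by exists phi; split; [apply: presLift_is_scalable | apply: presLift_var].
Qed.

End PresentedLift.

(** The image contains [1] and is closed under sums, scalar multiples and left multiplication by
    generators, so [freeAlg_ind] applies. *)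
Lemma presAlg_rmorphism_surj (F : fieldType) (X Y : choiceType)
    (relX : freeAlg F X -> freeAlg F X -> Prop)
    (relY : freeAlg F Y -> freeAlg F Y -> Prop)
    (phi : {rmorphism presAlg relX -> presAlg relY}) :
    scalable phi -> (forall y, exists x, phi x = pvar relY y) ->
  forall z, exists x, phi x = z.
Proof.
move=> phiZ phi_var z; have [u <-] := presPi_surj z.
elim/freeAlg_ind: u => [|u w [x xE] [y yE]|a u [x xE]|g u [x xE]].
- by exists 1; rewrite !rmorph1.
- by exists (x + y); rewrite !raddfD /= xE yE.
- by exists (a *: x); rewrite phiZ xE linearZ.
- by have [y yE] := phi_var g; exists (y * x); rewrite !rmorphM /= xE yE.
Qed.

(** Turns the quadratic relation into an inverse relation: the left side vanishes exactly when
    [(a + a^-1)%:A - x] is a right inverse of [x]. *)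
Lemma quadratic_factor (F : fieldType) (A : algType F) (a : F) (x : A) :
    a != 0 ->
  (x - a%:A) * (x - a^-1%:A) = 1 - x * ((a + a^-1)%:A - x).
Proof.
move=> a0; rewrite mulrBl !mulrBr !mulr_algr mulr_algl scalerA mulVf //.
by rewrite scale1r scalerDl !opprB opprD [LHS]addrC addrACA -addrA.
Qed.

(** * The relations of the universal algebra hold in H *)

Section DAHARelations.
Variables (F : fieldType) (k0 k1 k0v k1v q : F).
Hypotheses (k0_neq0 : k0 != 0) (k1_neq0 : k1 != 0).
Hypotheses (k0v_neq0 : k0v != 0) (k1v_neq0 : k1v != 0).

Local Notation k := (daha_param k0 k1 k0v k1v).
Local Notation rel := (daha_rel k0 k1 k0v k1v q).
Local Notation t := (fvar F (X := daha_gen)).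

Definition daha_trace (g : daha_gen) : F := k g + (k g)^-1.

Definition daha_free_inv (g : daha_gen) : freeAlg F daha_gen :=
  (daha_trace g)%:A - t g.

Definition hat_to_daha (x : hat_gen) : freeAlg F daha_gen :=
  match x with inl g => t g | inr g => daha_free_inv g end.

Let k_neq0 g : k g != 0. Proof. by case: g. Qed.

Lemma daha_mulV g : presPi rel (t g * daha_free_inv g) = 1.
Proof.
apply/eqP; rewrite eq_sym -subr_eq0 -(rmorph1 (presPi rel)) -raddfB.
rewrite -quadratic_factor // -(raddf0 (presPi rel)); apply/eqP/presPi_eqP.
exact/relIdeal_rel/daha_rel_quadratic.
Qed.

(** A scalar minus [t g] commutes with [t g], so the right inverse from [daha_mulV] is also a left
    inverse. *)
Lemma daha_free_invC g : daha_free_inv g * t g = t g * daha_free_inv g.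
Proof. by rewrite mulrBl mulrBr mulr_algl mulr_algr. Qed.

Lemma daha_prodE :
  presPi rel (t T0v * t T0 * t T1v * t T1) = q^-1 *: (1 : presAlg rel).
Proof.
rewrite -(rmorph1 (presPi rel)) -linearZ; apply/presPi_eqP.
exact/relIdeal_rel/daha_rel_prod.
Qed.

Lemma daha_hat_rel u w : hat_rel u w ->
  presPi rel (freeEval hat_to_daha u) = presPi rel (freeEval hat_to_daha w).
Proof.
have [ev evE] : exists ev : {rmorphism freeAlg F hat_gen -> presAlg rel},
    ev =1 presPi rel \o freeEval hat_to_daha.
  by exists (presPi rel \o freeEval hat_to_daha : {rmorphism _ -> _}).
have ev_var x : ev (fvar F x) = presPi rel (hat_to_daha x).
  by rewrite evE /= freeEval_var.
(* Both centrality relations reduce to this: an element whose image is a scalar has central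
   image. *)
have ev_central (a : F) z y :
    ev z = a *: (1 : presAlg rel) -> ev (z * y) = ev (y * z).
  move=> zE; rewrite [LHS]rmorphM [RHS]rmorphM zE.
  by rewrite -presAlg_scalerAl -presAlg_scalerAr mul1r mulr1.
rewrite -[LHS]evE -[RHS]evE; case=> [g|g|g y|y].
- by rewrite rmorphM rmorph1 !ev_var -(daha_mulV g) rmorphM.
- by rewrite rmorphM rmorph1 !ev_var -(daha_mulV g) -daha_free_invC rmorphM.
- apply: (ev_central (daha_trace g)).
  by rewrite rmorphD !ev_var -raddfD /= addrC subrK linearZ rmorph1.
- apply: (ev_central q^-1).
  by rewrite !rmorphM !ev_var -daha_prodE !rmorphM.
Qed.

End DAHARelations.

Theorem lemma3p4 (F : fieldType) (k0 k1 k0v k1v q : F)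
    (k0_neq0 : k0 != 0) (k1_neq0 : k1 != 0)
    (k0v_neq0 : k0v != 0) (k1v_neq0 : k1v != 0) (q_neq0 : q != 0) :
  exists phi : {rmorphism hatH F -> dahaH k0 k1 k0v k1v q},
    [/\ scalable phi,
        forall y : dahaH k0 k1 k0v k1v q, exists x : hatH F, phi x = y,
        phi (hatQ F) = q *: (1 : dahaH k0 k1 k0v k1v q)
      & forall g : daha_gen, phi (hat_t F g) = daha_t k0 k1 k0v k1v q g].
Proof.
have [phi [phiZ phi_var]] := presLift_rmorphism
  (daha_hat_rel q k0_neq0 k1_neq0 k0v_neq0 k1v_neq0).
have phi_t g : phi (hat_t F g) = daha_t k0 k1 k0v k1v q g by apply: phi_var.
exists phi; split=> //.
- apply: (presAlg_rmorphism_surj phiZ) => g.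
  by exists (hat_t F g); apply: phi_t.
have phi_prod : phi (hat_prod F) = q^-1 *: (1 : dahaH k0 k1 k0v k1v q).
  rewrite -[RHS](daha_prodE k0 k1 k0v k1v q) /hat_prod !rmorphM /=.
  by rewrite !phi_t.
(* As [phi] sends the product to [q^-1], this equation reads [q^-1 *: phi (hatQ F) = 1]; scaling by
   [q] gives the value at [hatQ]. *)
have : phi (hat_prod F) * phi (hatQ F) = 1.
  by rewrite -rmorphM hat_prodQ rmorph1.
rewrite phi_prod -presAlg_scalerAl mul1r => <-.
by rewrite scalerA mulfV // scale1r.
Qed.
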